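(* Let $H$ be an infinite-dimensional real Hilbert space, viewed as a metric structure in the many-sorted signature described in the context, and let $T:H\to H$ be a bounded linear map. Then $T$ is definable if and only if there exist $\lambda\in\mathbb{R}$ and a compact operator $K:H\to H$ such that $T=\lambda I+K$, where $I$ is the identity operator on $H$.
   Context: $H$ is treated as a many-sorted metric structure in continuous logic: for each $n\ge 1$ there is a sort for the closed ball $B_n(H)=\{x\in H:\|x\|\le n\}$, with metric $d(x,y)=\|x-y\|$; there are function symbols for the inclusions $B_m(H)\to B_n(H)$ ($m\le n$), for $+,-:B_n(H)\times B_n(H)\to B_{2n}(H)$, for multiplication by each $r\in\mathbb{R}$ as a map $B_n(H)\to B_{kn}(H)$ where $k\in\mathbb{N}$ satisfies $k-1\le |r|<k$, and predicate symbols for the inner product $B_n(H)\times B_n(H)\to[-n^2,n^2]$ and the norm $B_n(H)\to[0,n]$. For $A\subseteq H$, a function $f:H\to H$ is called $A$-definable if (1) for each $n\ge1$, $f(B_n(H))$ is bounded (let $m(n,f)$ be the least $m\in\mathbb{N}$ with $f(B_n(H))\subseteq B_m(H)$), and (2) for each $n\ge 1$ and each $m\ge m(n,f)$, the predicate $P_{n,m}:B_n(H)\times B_m(H)\to\mathbb{R}$, $P_{n,m}(x,y)=d(f(x),y)$, is an $A$-definable predicate in the sense of continuous logic (i.e. a uniform limit on its domain of formulas with parameters from $A$). A function is definable if it is $A$-definable for some $A\subseteq H$. *)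

(* Defs.v *)
From HB Require Import structures.
From mathcomp Require Import all_boot all_order all_algebra.
From mathcomp Require Import all_classical all_reals all_analysis.
Set Implicit Arguments.
Unset Strict Implicit.
Unset Printing Implicit Defensive.
Import Order.TTheory GRing.Theory Num.Theory.
Import numFieldNormedType.Exports.
Local Open Scope classical_set_scope.
Local Open Scope ring_scope.

(* A real Hilbert space is a complete normed space together with an inner
   product inducing its norm; positive definiteness follows from [ip_norm]. *)
Record inner_product (R : realType) (H : normedModType R) (ip : H -> H -> R)
    : Prop := InnerProduct {
  ip_sym : forall x y, ip x y = ip y x ;
  ip_addl : forall x y z, ip (x + y) z = ip x z + ip y z ;
  ip_scalel : forall r x y, ip (r *: x) y = r * ip x y ;
  ip_norm : forall x, ip x x = `|x| ^+ 2 }.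

Definition infinite_dimensional (R : realType) (H : lmodType R) : Prop :=
  ~ exists (n : nat) (v : 'I_n -> H),
      forall x : H, exists c : 'I_n -> R, x = \sum_(i < n) c i *: v i.

Definition bounded_operator (R : realType) (H : normedModType R)
    (T : {linear H -> H}) : Prop :=
  exists C : R, forall x : H, `|T x| <= C * `|x|.

Definition cball (R : realType) (H : normedModType R) (n : nat) : set H :=
  [set x | `|x| <= n%:R].
Arguments cball {R} H n.

Definition compact_operator (R : realType) (H : normedModType R)
    (K : {linear H -> H}) : Prop :=
  precompact (K @` cball H 1).

(* Sorts are indexed by the naturals n >= 1, the sort n being [cball H n].
   A context G lists the sorts of the free variables, in de Bruijn style: the
   variable i has sort [nth 0 G i], and quantifiers add a sort at the head.
   Index 0 is not a sort: it cannot occur in a term over a context of positive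
   sorts, since parameters and quantifiers only involve positive indices and
   the function symbols map positive indices to positive ones. *)
Inductive term (R : realType) (H : normedModType R) (A : set H)
    (G : seq nat) : nat -> Type :=
| TVar (i : nat) of (i < size G)%N : term A G (nth 0%N G i)
| TCst (n : nat) (a : H) of (0 < n)%N & A a & cball H n a : term A G n
| TIncl (m n : nat) of (m <= n)%N & term A G m : term A G n
| TAdd (n : nat) of term A G n & term A G n : term A G (2 * n)%N
| TSub (n : nat) of term A G n & term A G n : term A G (2 * n)%N
| TScale (n k : nat) (r : R) of k%:R - 1 <= `|r| < k%:R & term A G n :
    term A G (k * n)%N.

(* The inclusions being interpreted by the identity, terms of sort n can be
   evaluated in H; [term_eval_cball] below states that the value is in
   [cball H n]. *)
Fixpoint term_eval (R : realType) (H : normedModType R) (A : set H)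
    (G : seq nat) (n : nat) (t : term A G n) (e : seq H) : H :=
  match t with
  | TVar i _ => nth 0 e i
  | TCst _ a _ _ _ => a
  | TIncl _ _ _ t1 => term_eval t1 e
  | TAdd _ t1 t2 => term_eval t1 e + term_eval t2 e
  | TSub _ t1 t2 => term_eval t1 e - term_eval t2 e
  | TScale _ _ r _ t1 => r *: term_eval t1 e
  end.

(* Formulas of continuous logic: the connectives are all the continuous
   functions R^k -> R, the quantifiers are sup and inf over a sort. *)
Inductive formula (R : realType) (H : normedModType R) (A : set H)
    (G : seq nat) : Type :=
| FDist (n : nat) of term A G n & term A G n
| FInner (n : nat) of term A G n & term A G n
| FNorm (n : nat) of term A G n
| FConn (k : nat) (u : 'rV[R]_k -> R) of continuous u & ('I_k -> formula A G)
| FSup (n : nat) of (0 < n)%N & formula A (n :: G)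
| FInf (n : nat) of (0 < n)%N & formula A (n :: G).

(* By [formula_bounded] below, the sup and inf are taken over bounded sets. *)
Fixpoint formula_eval (R : realType) (H : normedModType R) (ip : H -> H -> R)
    (A : set H) (G : seq nat) (phi : formula A G) (e : seq H) : R :=
  match phi with
  | FDist _ t1 t2 => `|term_eval t1 e - term_eval t2 e|
  | FInner _ t1 t2 => ip (term_eval t1 e) (term_eval t2 e)
  | FNorm _ t => `|term_eval t e|
  | FConn k u _ phis => u (\row_(i < k) formula_eval ip (phis i) e)
  | FSup n _ psi => sup [set formula_eval ip psi (x :: e) | x in cball H n]
  | FInf n _ psi => inf [set formula_eval ip psi (x :: e) | x in cball H n]
  end.

Definition definable_predicate (R : realType) (H : normedModType R)
    (ip : H -> H -> R) (A : set H) (n m : nat) (P : H -> H -> R) : Prop :=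
  exists phi : nat -> formula A [:: n; m],
    forall eps : R, 0 < eps ->
      exists N : nat, forall k : nat, (N <= k)%N ->
        forall x y : H, cball H n x -> cball H m y ->
          `|formula_eval ip (phi k) [:: x; y] - P x y| <= eps.

Definition least_bound (R : realType) (H : normedModType R) (f : H -> H)
    (n m : nat) : Prop :=
  f @` cball H n `<=` cball H m /\
  forall j : nat, f @` cball H n `<=` cball H j -> (m <= j)%N.

(* The least bound can be 0 (when f vanishes on the ball), but m has to be a
   sort, whence [0 < m]. *)
Definition definable_over (R : realType) (H : normedModType R)
    (ip : H -> H -> R) (A : set H) (f : H -> H) : Prop :=
  (forall n : nat, (0 < n)%N -> bounded_set (f @` cball H n)) /\
  (forall n m0 m : nat, (0 < n)%N -> least_bound f n m0 ->
     (m0 <= m)%N -> (0 < m)%N ->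
     definable_predicate ip A n m (fun x y => `|f x - y|)).

Definition definable (R : realType) (H : normedModType R)
    (ip : H -> H -> R) (f : H -> H) : Prop :=
  exists A : set H, definable_over ip A f.

Definition env_in (R : realType) (H : normedModType R) (G : seq nat)
    (e : seq H) : Prop :=
  forall i : nat, (i < size G)%N -> cball H (nth 0%N G i) (nth 0 e i).

Lemma term_eval_cball (R : realType) (H : normedModType R) (A : set H)
    (G : seq nat) (n : nat) (t : term A G n) (e : seq H) :
  env_in G e -> cball H n (term_eval t e).
Proof.
move=> eG; elim: t => {n} /=.
- by move=> i iG; exact: eG.
- by [].
- move=> m n mn t; rewrite /cball /= => /le_trans; apply.
  by rewrite ler_nat.
- move=> n t1 + t2; rewrite /cball /= => h1 h2.
  by rewrite mul2n -addnn natrD (le_trans (ler_normD _ _))// lerD.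
- move=> n t1 + t2; rewrite /cball /= => h1 h2.
  by rewrite mul2n -addnn natrD (le_trans (ler_normB _ _))// lerD.
- move=> n k r /andP[_ rk] t; rewrite /cball /= => h.
  by rewrite normrZ natrM ler_pM// ltW.
Qed.

Lemma inner_product_le (R : realType) (H : normedModType R)
    (ip : H -> H -> R) (x y : H) : inner_product ip ->
  `|ip x y| <= (`|x| + `|y|) ^+ 2 + `|x| ^+ 2 + `|y| ^+ 2.
Proof.
move=> hip.
have E : ip (x + y) (x + y) = ip x x + ip x y *+ 2 + ip y y.
  rewrite (ip_addl hip) (ip_sym hip x (x + y)) (ip_sym hip y (x + y)).
  by rewrite !(ip_addl hip) (ip_sym hip y x) mulr2n !addrA.
move: E; rewrite !(ip_norm hip) => E.
have h : `|x + y| ^+ 2 <= (`|x| + `|y|) ^+ 2.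
  by rewrite ler_sqr ?nnegrE ?addr_ge0 ?ler_normD.
have h2 : `|ip x y| <= `|ip x y *+ 2|.
  by rewrite normrMn mulr2n lerDl.
apply: (le_trans h2).
have -> : ip x y *+ 2 = `|x + y| ^+ 2 - (`|x| ^+ 2 + `|y| ^+ 2).
  by rewrite E [_ + _ + `|y| ^+ 2]addrAC [RHS]addrC addKr.
rewrite (le_trans (ler_normB _ _))// -addrA.
by rewrite !ger0_norm ?addr_ge0 ?sqr_ge0// lerD.
Qed.

Lemma formula_bounded (R : realType) (H : normedModType R)
    (ip : H -> H -> R) (A : set H) (G : seq nat) (phi : formula A G) :
  inner_product ip ->
  exists C : R, forall e, env_in G e -> `|formula_eval ip phi e| <= C.
Proof.
move=> hip; elim: phi => {G} G /=.
- move=> n t1 t2; exists (n%:R + n%:R) => e eG; rewrite normr_id.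
  have := term_eval_cball t1 eG; have := term_eval_cball t2 eG.
  by rewrite /cball /= => h2 h1; rewrite (le_trans (ler_normB _ _))// lerD.
- move=> n t1 t2; exists ((n%:R + n%:R) ^+ 2 + n%:R ^+ 2 + n%:R ^+ 2) => e eG.
  have := term_eval_cball t1 eG; have := term_eval_cball t2 eG.
  rewrite /cball /= => h2 h1; rewrite (le_trans (inner_product_le _ _ hip))//.
  by rewrite !lerD// ler_sqr ?nnegrE ?addr_ge0// lerD.
- move=> n t; exists n%:R => e eG; rewrite normr_id.
  exact: (term_eval_cball t eG).
- move=> k u cu phis IH.
  have [C hC] := choice IH.
  have cK : compact [set v : 'rV[R]_k | forall i,
      `[- C i, C i]%classic (v ord0 i)].
    by apply: (@rV_compact R k (fun i => `[- C i, C i]%classic)) => i;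
      exact: segment_compact.
  have /compact_bounded[M [_ hM]] :=
    continuous_compact (continuous_subspaceT cu) cK.
  exists (M + 1) => e eG; apply: (hM (M + 1)); first by rewrite ltrDl.
  exists (\row_i formula_eval ip (phis i) e) => // i.
  by rewrite mxE /= in_itv /= -ler_norml; exact: hC.
- move=> n n0 psi [C hC]; exists C => e eG.
  have hE x : cball H n x -> `|formula_eval ip psi (x :: e)| <= C.
    by move=> nx; apply: hC; case.
  have H0 : cball H n 0 by rewrite /cball /= normr0.
  rewrite ler_norml; apply/andP; split.
    apply: (@le_trans _ _ (formula_eval ip psi (0 :: e))).
      by have := hE _ H0; rewrite ler_norml => /andP[].
    apply: ub_le_sup; last by exists 0.
    by exists C => _ [x /hE hx <-]; rewrite (le_trans (ler_norm _)).
  apply: ge_sup; first by exists (formula_eval ip psi (0 :: e)), 0.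
  by move=> _ [x /hE hx <-]; rewrite (le_trans (ler_norm _)).
- move=> n n0 psi [C hC]; exists C => e eG.
  have hE x : cball H n x -> `|formula_eval ip psi (x :: e)| <= C.
    by move=> nx; apply: hC; case.
  have H0 : cball H n 0 by rewrite /cball /= normr0.
  rewrite ler_norml; apply/andP; split.
    apply: lb_le_inf; first by exists (formula_eval ip psi (0 :: e)), 0.
    by move=> _ [x /hE + <-]; rewrite ler_norml => /andP[].
  apply: (@le_trans _ _ (formula_eval ip psi (0 :: e))).
    apply: ge_inf; last by exists 0.
    by exists (- C) => _ [x /hE + <-]; rewrite ler_norml => /andP[].
  by have := hE _ H0; rewrite ler_norml => /andP[].
Qed.

(* Main.v *)
Require Import Defs.
From HB Require Import structures.
From mathcomp Require Import all_boot all_order all_algebra.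
From mathcomp Require Import ring lra.
From mathcomp Require Import all_classical all_reals all_analysis.
Set Implicit Arguments.
Unset Strict Implicit.
Unset Printing Implicit Defensive.
Import Order.TTheory GRing.Theory Num.Theory.
Import numFieldNormedType.Exports.
Local Open Scope classical_set_scope.
Local Open Scope ring_scope.

(* If [T] is definable, approximate [|T x - y|] within [eps] by a formula. The
   formula has finitely many parameters, so it is invariant under the
   reflections along unit vectors orthogonal to them; hence [T] commutes with
   these reflections up to [2 eps]. This makes [T] nearly a scalar on the
   orthogonal of the parameters, the scalars converge as [eps] tends to 0, and
   subtracting the limit from [T] leaves an operator that is small on subspaces
   of finite codimension, i.e. a compact one.
   Conversely a compact [K] is a norm limit of operators of the form
   [x |-> \sum_i <x, a_i> e_i], and for these [|lambda x + K x - y|^2] is a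
   polynomial in inner products between [x], [y] and parameters. *)

(** * Projections, approximate Riesz representation and reflections *)

Section InnerProduct.
Variables (R : realType) (H : normedModType R) (ip : H -> H -> R).
Hypothesis hip : inner_product ip.

Lemma ipDl x y z : ip (x + y) z = ip x z + ip y z.
Proof. exact: ip_addl hip x y z. Qed.

Lemma ipZl r x y : ip (r *: x) y = r * ip x y.
Proof. exact: ip_scalel hip r x y. Qed.

Lemma ipC x y : ip x y = ip y x.
Proof. exact: ip_sym hip x y. Qed.

Lemma ipDr x y z : ip z (x + y) = ip z x + ip z y.
Proof. by rewrite ipC ipDl !(ipC z). Qed.

Lemma ipZr r x y : ip x (r *: y) = r * ip x y.
Proof. by rewrite ipC ipZl (ipC x). Qed.

Lemma ip0l x : ip 0 x = 0.
Proof. by rewrite -(scale0r 0) ipZl mul0r. Qed.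

Lemma ip0r x : ip x 0 = 0.
Proof. by rewrite ipC ip0l. Qed.

Lemma ipNl x y : ip (- x) y = - ip x y.
Proof. by rewrite -scaleN1r ipZl mulN1r. Qed.

Lemma ipNr x y : ip x (- y) = - ip x y.
Proof. by rewrite -scaleN1r ipZr mulN1r. Qed.

Definition ipE := (ipDl, ipDr, ipZl, ipZr, ipNl, ipNr).

Lemma ip_suml I (s : seq I) (F : I -> H) y :
  ip (\sum_(i <- s) F i) y = \sum_(i <- s) ip (F i) y.
Proof.
by elim: s => [|i s IHs]; rewrite ?big_nil ?ip0l// !big_cons ipDl IHs.
Qed.

Lemma ip_sumr I (s : seq I) (F : I -> H) y :
  ip y (\sum_(i <- s) F i) = \sum_(i <- s) ip y (F i).
Proof. by rewrite ipC ip_suml; apply: eq_bigr => i _; rewrite ipC. Qed.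

Lemma ipxx x : ip x x = `|x| ^+ 2.
Proof. exact: ip_norm hip x. Qed.

Lemma normDsqr x y : `|x + y| ^+ 2 = `|x| ^+ 2 + 2 * ip x y + `|y| ^+ 2.
Proof. by rewrite -!ipxx !ipE (ipC y x); ring. Qed.

Lemma cauchy_schwarz x y : `|ip x y| <= `|x| * `|y|.
Proof.
have [->|y0] := eqVneq y 0; first by rewrite ip0r !normr0 mulr0.
have yy : 0 < `|y| ^+ 2 by rewrite exprn_gt0// normr_gt0.
have := sqr_ge0 `| `|y| ^+ 2 *: x - ip x y *: y|.
have -> : `| `|y| ^+ 2 *: x - ip x y *: y| ^+ 2 =
    `|y| ^+ 2 * ((`|x| * `|y|) ^+ 2 - ip x y ^+ 2).
  by rewrite -[LHS]ipxx !ipE !ipxx (ipC y x); ring.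
rewrite pmulr_rge0// subr_ge0 -[ip x y ^+ 2]real_normK ?num_real//.
by rewrite ler_sqr ?nnegrE ?mulr_ge0.
Qed.

(* This is the orthogonal projection onto the span of [e] only if it fixes the
   elements of [e]; that condition stands in for orthonormality below. *)
Definition proj (e : seq H) (x : H) : H := \sum_(a <- e) ip x a *: a.

Lemma proj_sym e x y : ip (proj e x) y = ip x (proj e y).
Proof.
rewrite ip_suml ip_sumr; apply: eq_bigr => a _.
by rewrite !ipE (ipC y a) mulrC.
Qed.

Lemma proj_fix_perp e u x : (forall a, a \in e -> ip u a = 0) ->
  proj e x = x -> ip x u = 0.
Proof.
move=> ue <-; rewrite proj_sym /proj big_seq big1 ?ip0r// => a /ue ->.
by rewrite scale0r.
Qed.

Lemma proj_perp e x y : proj e y = y -> ip (x - proj e x) y = 0.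
Proof. by move=> yP; rewrite !ipE proj_sym yP subrr. Qed.

(** A vector [b] not yet fixed contributes its normalised residual [u]. As [u] is orthogonal to [e],
    whatever [proj e] fixes stays fixed, and [b] becomes fixed. *)
Lemma gram_schmidt (s : seq H) : exists e : seq H,
  (forall a, a \in e -> proj e a = a) /\ (forall b, b \in s -> proj e b = b).
Proof.
elim: s => [|b s [e [ee es]]]; first by exists [::].
have [bP|bP] := eqVneq (proj e b) b.
  by exists e; split=> // c; rewrite inE => /orP[/eqP->//|/es].
pose c := b - proj e b; pose u := `|c|^-1 *: c.
have c0 : `|c| != 0 by rewrite normr_eq0 subr_eq0 eq_sym.
have ue a : a \in e -> ip u a = 0.
  by move=> ae; rewrite ipZl proj_perp ?mulr0//; exact: ee.
have fixE x : proj e x = x -> proj (u :: e) x = x.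
  move=> xP; rewrite /proj big_cons -/(proj e x) xP.
  by rewrite (proj_fix_perp ue xP) scale0r add0r.
have Pu : proj e u = 0.
  by rewrite /proj big_seq big1// => a /ue ->; rewrite scale0r.
have uu : ip u u = 1.
  by rewrite ipZl ipZr ipxx; field.
have bu : ip b u = `|c|.
  have -> : b = c + proj e b by rewrite subrK.
  by rewrite ipDl proj_sym Pu ip0r addr0 ipZr ipxx; field.
exists (u :: e); split=> a; rewrite inE => /orP[/eqP->|].
- by rewrite /proj big_cons -/(proj e u) Pu uu scale1r addr0.
- by move=> /ee /fixE.
- rewrite /proj big_cons -/(proj e b) bu scalerA divff// scale1r.
  by rewrite subrK.
- by move=> /es /fixE.
Qed.

(** Pythagoras: [x - proj e x] is orthogonal to [proj e x - y], both terms of which are fixed by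
    [proj e]. *)
Lemma proj_dist_le e x y : (forall a, a \in e -> proj e a = a) ->
  proj e y = y -> `|x - proj e x| <= `|x - y|.
Proof.
move=> eP yP; rewrite -ler_sqr ?nnegrE//.
have -> : x - y = (x - proj e x) + (proj e x - y).
  by rewrite addrA subrK.
rewrite [leRHS]normDsqr ipDr ipNr (proj_perp x yP) proj_perp//; last first.
  rewrite {1 3}/proj big_seq [RHS]big_seq.
  by apply: eq_bigr => a ae; rewrite proj_sym eP.
by rewrite subr0 mulr0 addr0 lerDl sqr_ge0.
Qed.

(* The minimum of [|a|^2 - 2 f a] is attained at the vector representing [f];
   a near-minimiser represents [f] approximately, which avoids taking limits. *)
Lemma riesz_approx (f : H -> R) (M d : R) :
  (forall x y, f (x + y) = f x + f y) -> (forall r x, f (r *: x) = r * f x) ->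
  (forall x, `|f x| <= M * `|x|) -> 0 < d ->
  exists a, forall x, `|f x - ip x a| <= d * `|x|.
Proof.
move=> fD fZ fM d0.
pose J a := `|a| ^+ 2 - 2 * f a.
have hJ : has_inf (range J).
  split; first by exists (J 0), 0.
  exists (- M ^+ 2) => _ [a _ <-]; rewrite /J.
  have /ler_normlP[_ h] := fM a.
  have := sqr_ge0 (`|a| - M); nra.
have [_ [a _ <-] ha] := inf_adherent (exprn_gt0 2 d0) hJ.
exists a => x.
have hx t : - d ^+ 2 <= t ^+ 2 * `|x| ^+ 2 - 2 * t * (f x - ip x a).
  have h : inf (range J) <= J (a + t *: x).
    by apply: ge_inf; [case: hJ|exists (a + t *: x)].
  suff <- : J (a + t *: x) - J a =
    t ^+ 2 * `|x| ^+ 2 - 2 * t * (f x - ip x a) by lra.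
  rewrite /J normDsqr fD fZ normrZ exprMn real_normK ?num_real//.
  by rewrite ipZr (ipC a); ring.
have [->|x0] := eqVneq x 0.
  by rewrite -(scale0r 0) fZ ipZl !mul0r subrr normr0 scale0r normr0 mulr0.
have xp : 0 < `|x| by rewrite normr_gt0.
(* At these two values of [t], the defect [d ^+ 2] of the near-minimum becomes an error of [d] times
   the norm of [x]. *)
move: (hx (d / `|x|)) (hx (- (d / `|x|))).
rewrite sqrrN exprMn exprVn mulfVK ?expf_neq0 ?gt_eqF//.
set g := f x - _ => h1 h2.
have E : d / `|x| * g = d * (g / `|x|) by ring.
have k1 : d * (g / `|x|) <= d * d by move: h1; rewrite expr2 -mulrA E; lra.
have k2 : d * (- (g / `|x|)) <= d * d.
  by move: h2; rewrite expr2 -mulrA mulNr E mulrN mulrN; lra.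
move: k1 k2; rewrite !ler_pM2l// -mulNr !ler_pdivrMr// => k1 k2.
by rewrite ler_norml lerNl k1 k2.
Qed.

(** For a unit vector [w], the reflection in the hyperplane orthogonal to [w]. These isometries act
    as automorphisms of the structure. *)
Definition reflection (w x : H) : H := x - (2 * ip x w) *: w.

Section Reflection.
Variable w : H.
Hypothesis w1 : `|w| = 1.
Local Notation U := (reflection w).

Lemma reflectionB x y : U (x - y) = U x - U y.
Proof.
by rewrite /reflection !ipE mulrDr mulrN scalerDl scaleNr !opprD !opprK addrACA.
Qed.

Lemma reflectionD x y : U (x + y) = U x + U y.
Proof.
by rewrite /reflection !ipE mulrDr scalerDl !opprD addrACA.
Qed.

Lemma reflectionZ r x : U (r *: x) = r *: U x.
Proof. by rewrite /reflection scalerBr ipZl scalerA mulrCA. Qed.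

Lemma reflection_perp x : ip x w = 0 -> U x = x.
Proof. by move=> xw; rewrite /reflection xw mulr0 scale0r subr0. Qed.

Lemma reflectionK : involutive U.
Proof.
move=> x; rewrite /reflection !ipE ipxx w1 expr1n.
have -> : 2 * (ip x w - 2 * ip x w * 1) = - (2 * ip x w) by ring.
by rewrite scaleNr opprK subrK.
Qed.

Lemma ip_reflection x y : ip (U x) (U y) = ip x y.
Proof. by rewrite /reflection !ipE ipxx w1 (ipC w y); ring. Qed.

Lemma norm_reflection x : `|U x| = `|x|.
Proof. by apply/eqP; rewrite -(@eqrXn2 _ 2)// -!ipxx ip_reflection. Qed.

End Reflection.

End InnerProduct.

(** * Invariance of terms and formulas under reflections *)

Section Invariance.
Variables (R : realType) (H : normedModType R) (ip : H -> H -> R).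
Hypothesis hip : inner_product ip.

(** The list [s] collects the parameters of [t]: reflections along directions orthogonal to them fix
    them, and pass through the operations by linearity. *)
Lemma term_reflection (A : set H) (G : seq nat) (n : nat) (t : term A G n) :
  exists s : seq H, forall w, (forall a, a \in s -> ip a w = 0) ->
    forall e, term_eval t (map (reflection ip w) e) =
              reflection ip w (term_eval t e).
Proof.
elim: t => {n} /=.
- move=> i _; exists [::] => w _ e.
  have [ie|ei] := ltnP i (size e); first by rewrite (nth_map 0).
  (* Beyond the environment the default 0 is read, which every reflection fixes. *)
  by rewrite !nth_default ?size_map// reflection_perp ?(ip0l hip).
- move=> n a _ _ _; exists [:: a] => w aw e.
  by rewrite reflection_perp// aw// mem_seq1.
- by move=> m n _ t.
- move=> n t1 [s1 h1] t2 [s2 h2]; exists (s1 ++ s2) => w sw e.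
  by rewrite h1 ?h2 ?(reflectionD hip)// => a a_s; apply: sw;
    rewrite mem_cat a_s ?orbT.
- move=> n t1 [s1 h1] t2 [s2 h2]; exists (s1 ++ s2) => w sw e.
  by rewrite h1 ?h2 ?(reflectionB hip)// => a a_s; apply: sw;
    rewrite mem_cat a_s ?orbT.
- move=> n k r _ t [s h]; exists s => w sw e.
  by rewrite h ?(reflectionZ hip).
Qed.

Lemma reflection_cball_image (w : H) (n : nat) (F : H -> R) : `|w| = 1 ->
  [set F (reflection ip w x) | x in cball H n] = [set F x | x in cball H n].
Proof.
move=> w1; rewrite eqEsubset; split=> _ [x nx <-]; exists (reflection ip w x).
- by rewrite /cball /= norm_reflection.
- by [].
- by rewrite /cball /= norm_reflection.
- by rewrite reflectionK.
Qed.

(** Only finitely many parameters occur, connectives having finite arity. Quantifiers are harmless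
    because reflections permute each ball. *)
Lemma formula_reflection (A : set H) (G : seq nat) (phi : formula A G) :
  exists s : seq H, forall w, `|w| = 1 -> (forall a, a \in s -> ip a w = 0) ->
    forall e, formula_eval ip phi (map (reflection ip w) e) =
              formula_eval ip phi e.
Proof.
elim: phi => {}G /=.
- move=> n t1 t2.
  have [[s1 h1] [s2 h2]] := (term_reflection t1, term_reflection t2).
  exists (s1 ++ s2) => w w1 sw e.
  rewrite h1 ?h2 -?(reflectionB hip) ?norm_reflection// => a a_s; apply: sw;
    by rewrite mem_cat a_s ?orbT.
- move=> n t1 t2.
  have [[s1 h1] [s2 h2]] := (term_reflection t1, term_reflection t2).
  exists (s1 ++ s2) => w w1 sw e.
  rewrite h1 ?h2 ?ip_reflection// => a a_s; apply: sw;
    by rewrite mem_cat a_s ?orbT.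
- move=> n t; have [s h] := term_reflection t.
  by exists s => w w1 sw e; rewrite h ?norm_reflection.
- move=> k u _ phis IH; have [s hs] := choice IH.
  exists (flatten (codom s)) => w w1 sw e; congr u.
  apply/rowP => i; rewrite !mxE; apply: hs => // a a_s; apply: sw.
  by apply/flattenP; exists (s i); rewrite ?codom_f.
- move=> n _ psi [s h]; exists s => w w1 sw e; congr sup.
  (* The bound variable is reflected along with the environment, so that the induction hypothesis
     applies. *)
  rewrite -(reflection_cball_image _
    (fun x => formula_eval ip psi (x :: _)) w1).
  by apply: eq_imagel => x _; rewrite -[in RHS](h w).
- move=> n _ psi [s h]; exists s => w w1 sw e; congr inf.
  rewrite -(reflection_cball_image _
    (fun x => formula_eval ip psi (x :: _)) w1).
  by apply: eq_imagel => x _; rewrite -[in RHS](h w).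
Qed.

End Invariance.

(** * Operators close to a scalar in finite codimension *)

Section NearScalar.
Variables (R : realType) (H : normedModType R) (ip : H -> H -> R).
Hypothesis hip : inner_product ip.

Lemma perp_unit (s : seq H) : infinite_dimensional H ->
  exists2 u : H, `|u| = 1 & forall a, a \in s -> ip a u = 0.
Proof.
move=> hdim; have [e [ee es]] := gram_schmidt hip s.
have [x xP] : exists x, proj ip e x <> x.
  apply/existsNP => eT; apply: hdim; exists (size e), (fun i => nth 0 e i) => x.
  exists (fun i => ip x (nth 0 e i)).
  by rewrite -{1}(eT x) /proj (big_nth 0) big_mkord.
have x0 : `|x - proj ip e x| != 0.
  by rewrite normr_eq0 subr_eq0 eq_sym; apply/eqP.
exists (`|x - proj ip e x|^-1 *: (x - proj ip e x)).
  by rewrite normrZ normfV normr_id mulVf.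
move=> a /es aP; rewrite (ipZr hip) (ipC hip) (proj_perp hip)//.
by rewrite mulr0.
Qed.

Variable T : {linear H -> H}.

(* Reflecting along a unit vector [x] of the orthogonal of [s] shows that [T x]
   is nearly a multiple of [x], and reflecting along the difference of two unit
   vectors shows that the factor is nearly the same for both. *)
Lemma near_commuting_near_scalar (s : seq H) (u : H) (eps : R) :
  0 <= eps -> `|u| = 1 -> (forall a, a \in s -> ip a u = 0) ->
  (forall w x, `|w| = 1 -> (forall a, a \in s -> ip a w = 0) -> `|x| <= 1 ->
     `|T (reflection ip w x) - reflection ip w (T x)| <= 2 * eps) ->
  forall x, (forall a, a \in s -> ip a x = 0) ->
    `|T x - ip (T u) u *: x| <= 3 * eps * `|x|.
Proof.
move=> eps0 u1 us hT.
(* The reflection along [u] negates [u], so the commutator at [u] is -2 times the component of [T u]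
   orthogonal to [u]. *)
have Tu : `|T u - ip (T u) u *: u| <= eps.
  have := hT u u u1 us; rewrite u1 => /(_ (lexx _)).
  have -> : reflection ip u u = - u.
    rewrite /reflection (ipxx hip) u1 expr1n mulr1 scaler_nat mulr2n.
    by rewrite opprD addrA subrr sub0r.
  rewrite linearN /reflection.
  have -> : - T u - (T u - (2 * ip (T u) u) *: u) =
      (- 2) *: (T u - ip (T u) u *: u).
    rewrite scalerBr scalerA !mulNr !scaleNr scaler_nat mulr2n.
    by rewrite opprB opprK !opprD -!addrA; congr (_ + _); rewrite addrC.
  by rewrite normrZ normrN ger0_norm// ler_pM2l.
have unit_case x : `|x| = 1 -> (forall a, a \in s -> ip a x = 0) ->
    `|T x - ip (T u) u *: x| <= 3 * eps.
  move=> x1 xs; have [->|xu] := eqVneq x u; first by lra.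
  have ux0 : `|u - x| != 0 by rewrite normr_eq0 subr_eq0 eq_sym.
  pose w := `|u - x|^-1 *: (u - x).
  have w1 : `|w| = 1 by rewrite normrZ normfV normr_id mulVf.
  have ws a : a \in s -> ip a w = 0.
    by move=> a_s; rewrite !(ipE hip) us// xs// subrr mulr0.
  (* As [u] and [x] have equal norms, the reflection along their difference exchanges them. *)
  have Uu : reflection ip w u = x.
    rewrite /reflection /w scalerA (ipZr hip).
    have -> : 2 * (`|u - x|^-1 * ip u (u - x)) * `|u - x|^-1 = 1.
      have E : 2 * ip u (u - x) = `|u - x| ^+ 2.
        rewrite -(ipxx hip) !(ipE hip) !(ipxx hip) u1 x1 (ipC hip x u); ring.
      have -> : 2 * (`|u - x|^-1 * ip u (u - x)) * `|u - x|^-1 =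
        (2 * ip u (u - x)) * `|u - x| ^- 2 by rewrite expr2 invfM; ring.
      by rewrite E mulfV// expf_neq0.
    by rewrite scale1r opprB addrCA subrr addr0.
  (* The constant 3 is 2 from the commutator at [u] plus 1 from [Tu], carried over by the
     isometry. *)
  have -> : T x - ip (T u) u *: x = (T (reflection ip w u) -
      reflection ip w (T u)) + reflection ip w (T u - ip (T u) u *: u).
    by rewrite (reflectionB hip) (reflectionZ hip) Uu addrA subrK.
  rewrite (le_trans (ler_normD _ _))// norm_reflection//.
  by have := hT w u w1 ws; rewrite u1 => /(_ (lexx _)); lra.
move=> x xs; have [->|x0] := eqVneq x 0.
  by rewrite linear0 scaler0 subrr normr0 mulr0.
have nx0 : `|x| != 0 by rewrite normr_eq0.
have := unit_case (`|x|^-1 *: x); rewrite normrZ normfV normr_id mulVf//.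
move=> /(_ erefl) h.
have {}h : `|T (`|x|^-1 *: x) - ip (T u) u *: (`|x|^-1 *: x)| <= 3 * eps.
  by apply: h => a a_s; rewrite (ipZr hip) xs ?mulr0.
rewrite linearZ /= scalerA mulrC -scalerA -scalerBr normrZ normfV normr_id in h.
by rewrite mulrC -ler_pdivrMl// lt_def nx0 normr_ge0.
Qed.

(** The list [s] stands for its orthogonal, a subspace of finite codimension. *)
Definition near_scalar (lambda eps : R) : Prop := exists s : seq H,
  forall x, (forall a, a \in s -> ip a x = 0) ->
    `|T x - lambda *: x| <= eps * `|x|.

(** In infinite dimension some unit vector is orthogonal to both lists, and the two estimates are
    compared there. *)
Lemma near_scalar_dist (l1 l2 e1 e2 : R) : infinite_dimensional H ->
  near_scalar l1 e1 -> near_scalar l2 e2 -> `|l1 - l2| <= e1 + e2.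
Proof.
move=> hdim [s1 h1] [s2 h2]; have [u u1 us] := perp_unit (s1 ++ s2) hdim.
have := h1 u; have := h2 u; rewrite u1 !mulr1 => k2 k1.
have -> : `|l1 - l2| = `|(T u - l2 *: u) - (T u - l1 *: u)|.
  by rewrite opprB [in RHS]addrC addrA subrK -scalerBl normrZ u1 mulr1.
rewrite (le_trans (ler_normB _ _))// addrC lerD//.
  by apply: k1 => a a_s; apply: us; rewrite mem_cat a_s.
by apply: k2 => a a_s; apply: us; rewrite mem_cat a_s orbT.
Qed.

(** By [near_scalar_dist] the intervals from [l - e] to [l + e] meet pairwise, so the supremum of
    their left ends lies in all of them. *)
Lemma near_scalar_limit : infinite_dimensional H ->
  (forall eps, 0 < eps -> exists l, near_scalar l eps) ->
  exists l, forall eps, 0 < eps -> near_scalar l eps.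
Proof.
move=> hdim hT.
pose L := [set r | exists l e, near_scalar l e /\ r = l - e].
have ubL l e : near_scalar l e -> ubound L (l + e).
  move=> le _ [l' [e' [le' ->]]].
  have /ler_normlP[h1 h2] := near_scalar_dist hdim le' le; lra.
have [l1 hl1] := hT 1 ltr01.
have hL : has_sup L.
  by split; [exists (l1 - 1), l1, 1|exists (l1 + 1); exact: ubL].
exists (sup L) => eps eps0.
have [l hl] := hT (eps / 2) ltac:(lra).
have hs : `|sup L - l| <= eps / 2.
  rewrite ler_distl; apply/andP; split.
    by apply: ub_le_sup; [case: hL|exists l, (eps / 2)].
  by apply: ge_sup; [case: hL|exact: ubL].
case: hl => s h; exists s => x xs.
have -> : T x - sup L *: x = (T x - l *: x) - (sup L - l) *: x.
  by rewrite scalerBl opprB addrA subrK.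
rewrite (le_trans (ler_normB _ _))// normrZ.
by have := h x xs; have := ler_wpM2r (normr_ge0 x) hs; lra.
Qed.

End NearScalar.

(** * Finite nets and precompactness *)

Section Nets.
Variable R : realType.

Definition finite_net (V : normedModType R) (S : set V) (d : R) : Prop :=
  exists s : seq V, forall x, S x -> exists2 a, a \in s & `|x - a| <= d.

Lemma precompact_finite_net (V : normedModType R) (S : set V) (d : R) :
  precompact S -> 0 < d -> finite_net S d.
Proof.
rewrite precompactE compact_cover => cS d0.
have [|x Sx|D _ hD] := cS V setT (fun x => ball x d).
- by move=> x _; exact: ball_open.
- by exists x => //; exact: ballxx.
exists (finmap.enum_fset D) => x /(@subset_closure _ S)/hD[a aD].
by rewrite -ball_normE /= distrC => /ltW xa; exists a.
Qed.

Lemma ultra_bigcup (X : Type) (I : eqType) (F : set_system X)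
    (B : I -> set X) (s : seq I) : UltraFilter F ->
  F [set x | exists2 i, i \in s & B i x] -> exists2 i, i \in s & F (B i).
Proof.
move=> UF; elim: s => [|i s IHs] hF.
  have FF : Filter F by exact: _.
  by have [x [j]] := filter_ex hF.
have [FB|FB] := in_ultra_setVsetC (B i) UF.
  by exists i; rewrite ?mem_head.
have [|j js FBj] := IHs; last by exists j; rewrite // inE js orbT.
apply: filterS2 FB hF => x nBx [j]; rewrite inE => /orP[/eqP->//|js Bj].
by exists j.
Qed.

(** An ultrafilter on the closure contains, for each radius, a ball around some net point; hence it
    is Cauchy and converges by completeness. *)
Lemma finite_nets_precompact (V : completeNormedModType R) (S : set V) :
  (forall d, 0 < d -> finite_net S d) -> precompact S.
Proof.
move=> hS; rewrite precompactE compact_ultra => F UF FS.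
have : cauchy F.
  apply: cauchy_exP => eps eps0.
  (* A quarter of [eps] for the net and a half for passing from the closure to [S] add up to less
     than [eps]. *)
  have [s hs] := hS (eps / 2 / 2) ltac:(lra).
  have [a _ Fa] : exists2 a, a \in s & F (ball a eps); last by exists a.
  apply: ultra_bigcup; apply: filterS FS => x /(_ (ball x (eps / 2))).
  case; first by apply: nbhsx_ballx; lra.
  move=> y [/hs[a a_s ya] xy]; exists a => //.
  move: xy; rewrite -!ball_normE /= => xy.
  rewrite distrC -(subrK y x) -addrA (le_lt_trans (ler_normD _ _))//; lra.
move=> /cauchy_cvg/cvg_ex[p Fp]; exists p; split=> // B pB.
have FSB : F (closure S `&` B^°).
  by apply: filterI => //; exact: Fp (nbhs_interior pB).
have [x [Sx Bx]] := filter_ex FSB.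
by have := Sx _ Bx.
Qed.

(** Meant for the vectors [K (proj ip e x)] with [x] in the unit ball, whose coefficients satisfy
    this bound by Cauchy-Schwarz. Nets for the first coefficient and for the tail are added. *)
Lemma finite_net_sum (V : normedModType R) (K : V -> V) (e : seq V) (d : R) :
  0 < d ->
  finite_net [set x | exists2 c : V -> R, (forall a, `|c a| <= `|a|) &
                      x = \sum_(a <- e) c a *: K a] d.
Proof.
elim: e d => [|b e IHe] d d0.
  exists [:: 0] => _ [c _ ->]; exists 0; first exact: mem_head.
  by rewrite big_nil subrr normr0 ltW.
have [s hs] := IHe (d / 2) ltac:(lra).
(* A coefficient error of this size costs at most [d / 2] after multiplication by [K b]; the summand
   1 keeps the divisor positive. *)
have db0 : 0 < d / 2 / (1 + `|K b|) by rewrite divr_gt0 ?ltr_pwDl//; lra.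
have pS : precompact (`[- `|b|, `|b|]%classic : set R).
  by apply: compact_precompact; [exact: Rhausdorff|exact: segment_compact].
have [r hr] := precompact_finite_net pS db0.
exists [seq t *: K b + y | t <- r, y <- s] => _ [c cb ->].
have [|t tr ct] := hr (c b); first by rewrite /= in_itv /= -ler_norml.
have [|y ys hy] := hs (\sum_(a <- e) c a *: K a); first by exists c.
exists (t *: K b + y); first by apply/allpairsP; exists (t, y).
rewrite big_cons opprD addrACA -scalerBl (le_trans (ler_normD _ _))//.
have -> : d = d / 2 + d / 2 by lra.
rewrite lerD// normrZ.
have h1 : 0 < 1 + `|K b| by rewrite ltr_pwDl.
move: ct; rewrite ler_pdivlMr// => ct; apply: le_trans ct.
by rewrite ler_wpM2l// lerDr.
Qed.

End Nets.

(** * From definable to scalar plus compact *)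

Section Forward.
Variables (R : realType) (H : completeNormedModType R) (ip : H -> H -> R).
Hypothesis hip : inner_product ip.

(** On the unit ball, [K (x - proj ip e x)] is small, while [K (proj ip e x)] has bounded
    coefficients on a fixed finite list and so admits a finite net. *)
Lemma near_zero_compact (K : {linear H -> H}) :
  (forall eps, 0 < eps -> near_scalar ip K 0 eps) -> compact_operator K.
Proof.
move=> hK; apply: finite_nets_precompact => d d0.
have [s hs] := hK (d / 2) ltac:(lra).
have [e [ee es]] := gram_schmidt hip s.
have [t ht] := finite_net_sum K e (d := d / 2) ltac:(lra).
exists t => _ [x x1 <-].
have [|y yt hy] := ht (K (proj ip e x)).
  exists (fun a => ip x a) => [a|]; last first.
    by rewrite /proj linear_sum; apply: eq_bigr => a _; rewrite linearZ.
  by rewrite (le_trans (cauchy_schwarz hip _ _))// ler_piMl.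
exists y => //.
have -> : K x - y = K (x - proj ip e x) + (K (proj ip e x) - y).
  by rewrite linearB /= addrA subrK.
rewrite (le_trans (ler_normD _ _))//.
have := hs (x - proj ip e x); rewrite scale0r subr0 => {}hs.
have {hs} h : `|K (x - proj ip e x)| <= d / 2 * `|x - proj ip e x|.
  by apply: hs => a /es aP; rewrite (ipC hip) (proj_perp hip).
have : `|x - proj ip e x| <= 1.
  have P0 : proj ip e 0 = 0.
    by rewrite /proj big1// => a _; rewrite (ip0l hip) scale0r.
  by have := proj_dist_le hip x ee P0; rewrite subr0 => /le_trans; exact.
by nra.
Qed.

(** The formula is at most [eps] at [(x, T x)], where the predicate vanishes, hence also at the
    reflected pair; there it is within [eps] of the predicate. *)
Lemma definable_near_commuting (T : {linear H -> H}) (eps : R) :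
  bounded_operator T -> definable ip T -> 0 < eps ->
  exists s : seq H, forall w x, `|w| = 1 ->
    (forall a, a \in s -> ip a w = 0) -> `|x| <= 1 ->
    `|T (reflection ip w x) - reflection ip w (T x)| <= 2 * eps.
Proof.
move=> [C hC] [A [_ hA]] eps0.
have : exists j, `[< [set T x | x in cball H 1] `<=` cball H j >].
  exists (Num.truncn C).+1; apply/asboolP => _ [x x1 <-].
  rewrite /cball /= (le_trans (hC x))//.
  have [C0|C0] := leP 0 C.
    by rewrite (le_trans _ (ltW (truncnS_gt C)))// ler_piMr.
  by rewrite (@le_trans _ _ 0)// mulr_le0_ge0// ltW.
move=> /ex_minnP[m0 /asboolP Tm0 min_m0].
have lb : least_bound T 1 m0.
  by split=> // j /asboolP; exact: min_m0.
(* The successor is taken because [m0] may be 0, which is not a sort. *)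
have [phi hphi] := hA 1%N m0 m0.+1 isT lb (leqnSn _) isT.
have [N hN] := hphi eps eps0.
have [s hs] := formula_reflection hip (phi N).
exists s => w x w1 ws x1.
have Tx : cball H m0.+1 (T x).
  have := Tm0 (T x) (ex_intro2 _ _ x x1 erefl).
  by rewrite /cball /= => /le_trans; apply; rewrite ler_nat.
have := hN N (leqnn _) x (T x) x1 Tx.
have := hN N (leqnn _) (reflection ip w x) (reflection ip w (T x)).
rewrite /cball /= !norm_reflection// => /(_ x1 Tx).
have := hs w w1 ws [:: x; T x]; rewrite /= => ->.
rewrite subrr normr0 subr0 => /ler_normlP[h1 h2] /ler_normlP[h3 h4]; lra.
Qed.

Lemma definable_scalar_compact (T : {linear H -> H}) :
  infinite_dimensional H -> bounded_operator T -> definable ip T ->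
  exists (lambda : R) (K : {linear H -> H}),
    compact_operator K /\ forall x : H, T x = lambda *: x + K x.
Proof.
move=> hdim bT dT.
have [|l hl] := near_scalar_limit hip (T := T) hdim.
  move=> eps eps0; have e0 : 0 < eps / 3 by lra.
  have [s hs] := definable_near_commuting bT dT e0.
  have [u u1 us] := perp_unit hip s hdim.
  exists (ip (T u) u), s => x xs.
  have := near_commuting_near_scalar hip (ltW e0) u1 us hs xs.
  by have -> : 3 * (eps / 3) = eps by lra.
pose k x := T x - l *: x.
have klin : linear k.
  move=> a x y; rewrite /k linearP !scalerDr opprD addrACA.
  by congr (_ + _); rewrite scalerN !scalerA mulrC.
pose K : {linear H -> H} := HB.pack k (GRing.isLinear.Build R H H *:%R k klin).
exists l, K; split; last by move=> x; rewrite /K /= /k addrC subrK.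
apply: near_zero_compact => eps /hl[s hs]; exists s => x xs.
by rewrite scale0r subr0; exact: hs.
Qed.

End Forward.

(** * Functions given exactly by terms and formulas with parameters in [H] *)

Section Expressible.
Variables (R : realType) (H : normedModType R) (ip : H -> H -> R).
Hypothesis hip : inner_product ip.
Variables n m : nat.

(** The sort [N] is left free, so that terms of different sorts can be combined after inclusion into
    a common one. *)
Definition term_fun (v : H -> H -> H) : Prop :=
  exists N (t : term [set: H] [:: n; m] N),
    forall x y, term_eval t [:: x; y] = v x y.

Definition formula_fun (g : H -> H -> R) : Prop :=
  exists phi : formula [set: H] [:: n; m],
    forall x y, formula_eval ip phi [:: x; y] = g x y.

Lemma term_fun_fst : term_fun (fun x _ => x).
Proof. by exists n, (@TVar R H setT [:: n; m] 0 isT). Qed.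

Lemma term_fun_snd : term_fun (fun _ y => y).
Proof. by exists m, (@TVar R H setT [:: n; m] 1 isT). Qed.

Lemma term_fun_cst a : term_fun (fun _ _ => a).
Proof.
have aN : cball H (Num.truncn `|a|).+1 a by rewrite /cball /= ltW// truncnS_gt.
by exists (Num.truncn `|a|).+1, (TCst [:: n; m] (ltn0Sn _) (I : setT a) aN).
Qed.

Lemma term_funB u v :
  term_fun u -> term_fun v -> term_fun (fun x y => u x y - v x y).
Proof.
move=> [N1 [t1 h1]] [N2 [t2 h2]].
exists (2 * maxn N1 N2)%N,
  (TSub (TIncl (leq_maxl _ _) t1) (TIncl (leq_maxr _ _) t2)).
by move=> x y /=; rewrite h1 h2.
Qed.

Lemma term_funZ r v : term_fun v -> term_fun (fun x y => r *: v x y).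
Proof.
move=> [N [t h]].
have rk : (Num.truncn `|r|).+1%:R - 1 <= `|r| < (Num.truncn `|r|).+1%:R.
  rewrite truncnS_gt andbT -natr1 addrK.
  by have /andP[] := truncn_itv (normr_ge0 r).
exists ((Num.truncn `|r|).+1 * N)%N, (TScale rk t).
by move=> x y /=; rewrite h.
Qed.

Lemma formula_fun_conn k (u : 'rV[R]_k -> R) (g : 'I_k -> H -> H -> R) :
  continuous u -> (forall i, formula_fun (g i)) ->
  formula_fun (fun x y => u (\row_i g i x y)).
Proof.
move=> cu hg; have [phi hphi] := choice hg.
exists (FConn cu phi) => x y /=; congr u.
by apply/rowP => i; rewrite !mxE.
Qed.

Lemma formula_fun_ip u v :
  term_fun u -> term_fun v -> formula_fun (fun x y => ip (u x y) (v x y)).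
Proof.
move=> [N1 [t1 h1]] [N2 [t2 h2]].
exists (FInner (TIncl (leq_maxl N1 N2) t1) (TIncl (leq_maxr _ _) t2)).
by move=> x y /=; rewrite h1 h2.
Qed.

Lemma formula_fun_cst c : formula_fun (fun _ _ => c).
Proof.
apply: (@formula_fun_conn 0 (fun=> c) (fun _ _ _ => 0)) => [|[]//].
exact: cst_continuous.
Qed.

Lemma formula_funD g h :
  formula_fun g -> formula_fun h -> formula_fun (fun x y => g x y + h x y).
Proof.
move=> hg hh.
have [||phi hphi] := @formula_fun_conn 2 (fun v => v ord0 ord0 + v ord0 ord_max)
  (fun i : 'I_2 => if i == ord0 then g else h).
- by move=> v; apply: continuousD; exact: coord_continuous.
- by move=> i; case: ifP.
- by exists phi => x y; rewrite hphi !mxE.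
Qed.

Lemma formula_funM g h :
  formula_fun g -> formula_fun h -> formula_fun (fun x y => g x y * h x y).
Proof.
move=> hg hh.
have [||phi hphi] := @formula_fun_conn 2 (fun v => v ord0 ord0 * v ord0 ord_max)
  (fun i : 'I_2 => if i == ord0 then g else h).
- by move=> v; apply: continuousM; exact: coord_continuous.
- by move=> i; case: ifP.
- by exists phi => x y; rewrite hphi !mxE.
Qed.

(** [Num.sqrt] is 0 on negative reals, hence continuous on all of [R] and a connective. *)
Lemma formula_fun_sqrt g :
  formula_fun g -> formula_fun (fun x y => Num.sqrt (g x y)).
Proof.
move=> hg.
have [||phi hphi] := @formula_fun_conn 1 (fun v => Num.sqrt (v ord0 ord0))
  (fun=> g).
- move=> v; apply: (@continuous_comp _ _ _ (fun v : 'rV[R]_1 => v ord0 ord0)).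
    exact: coord_continuous.
  exact: sqrt_continuous.
- by [].
- by exists phi => x y; rewrite hphi !mxE.
Qed.

Lemma formula_fun_sum I (s : seq I) (g : I -> H -> H -> R) :
  (forall i, formula_fun (g i)) ->
  formula_fun (fun x y => \sum_(i <- s) g i x y).
Proof.
move=> hg; elim: s => [|i s IHs].
  have [phi hphi] := formula_fun_cst 0.
  by exists phi => x y; rewrite big_nil.
have [phi hphi] := formula_funD (hg i) IHs.
by exists phi => x y; rewrite big_cons.
Qed.

(** The coefficients depend on [x], so terms do not directly provide the sum. The squared norm,
    however, expands into a polynomial in inner products of terms, of which the square root is
    taken. *)
Lemma formula_fun_finite_rank (lambda : R) (l : seq (H * H)) :
  formula_fun (fun x y =>
    `|lambda *: x - y + \sum_(p <- l) ip x p.2 *: p.1|).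
Proof.
pose w (x y : H) : H := lambda *: x - y.
have hw : term_fun w := term_funB (term_funZ lambda term_fun_fst) term_fun_snd.
have hc (p : H * H) : formula_fun (fun x _ => ip x p.2).
  exact: formula_fun_ip term_fun_fst (term_fun_cst _).
have h1 := formula_fun_sum l (fun p => formula_funM (hc p)
  (formula_fun_ip hw (term_fun_cst p.1))).
have h2 := formula_fun_sum l (fun p => formula_fun_sum l (fun q =>
  formula_funM (formula_funM (hc p) (hc q)) (formula_fun_cst (ip p.1 q.1)))).
have [phi hphi] := formula_fun_sqrt (formula_funD (formula_funD
  (formula_fun_ip hw hw) (formula_funM (formula_fun_cst 2) h1)) h2).
exists phi => x y; rewrite hphi -[RHS](ger0_norm (normr_ge0 _)) -sqrtr_sqr.
congr Num.sqrt; rewrite (normDsqr hip) -!(ipxx hip) -/(w x y).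
congr (_ + _ * _ + _).
  by rewrite (ip_sumr hip); apply: eq_bigr => p _; rewrite (ipZr hip).
rewrite (ip_suml hip); apply: eq_bigr => p _; rewrite (ip_sumr hip).
by apply: eq_bigr => q _; rewrite (ipZl hip) (ipZr hip) mulrA.
Qed.

End Expressible.

(** * From scalar plus compact to definable *)

Section Backward.
Variables (R : realType) (H : normedModType R) (ip : H -> H -> R).
Hypothesis hip : inner_product ip.

(** Some [proj ip e] fixes a net of the image of the unit ball, and [K x] is no farther from its
    projection than from the net; the rest is homogeneity. *)
Lemma compact_near_proj (K : {linear H -> H}) (eps : R) :
  compact_operator K -> 0 < eps ->
  exists e, forall x, `|K x - proj ip e (K x)| <= eps * `|x|.
Proof.
move=> cK eps0; have [s hs] := precompact_finite_net cK eps0.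
have [e [ee es]] := gram_schmidt hip s; exists e => x.
have unit_case y : `|y| <= 1 -> `|K y - proj ip e (K y)| <= eps.
  move=> y1; have [|a a_s] := hs (K y); first by exists y.
  by apply: le_trans; apply: (proj_dist_le hip) => //; exact: es.
have [->|x0] := eqVneq x 0.
  rewrite linear0 /proj big1 ?subrr ?normr0 ?mulr0// => a _.
  by rewrite (ip0l hip) scale0r.
have nx0 : `|x| != 0 by rewrite normr_eq0.
have := unit_case (`|x|^-1 *: x).
rewrite normrZ normfV normr_id mulVf// linearZ /= => /(_ (lexx _)).
have -> : proj ip e (`|x|^-1 *: K x) = `|x|^-1 *: proj ip e (K x).
  rewrite /proj scaler_sumr; apply: eq_bigr => a _.
  by rewrite (ipZl hip) scalerA.
rewrite -scalerBr normrZ normfV normr_id ler_pdivrMl 1?mulrC//.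
by rewrite lt_def nx0 normr_ge0.
Qed.

(** Each coefficient [ip (K x) b] is a bounded functional of [x], which [riesz_approx] replaces by
    some [ip x a] in place of an adjoint. *)
Lemma proj_near_finite_rank (K : {linear H -> H}) (e : seq H) (eps : R) :
  bounded_operator K -> 0 < eps -> exists l : seq (H * H), forall x,
    `|proj ip e (K x) - \sum_(p <- l) ip x p.2 *: p.1| <= eps * `|x|.
Proof.
move=> [M hM]; elim: e eps => [|b e IHe] eps eps0.
  exists [::] => x; rewrite /proj !big_nil subrr normr0.
  by rewrite mulr_ge0// ltW.
have b0 : 0 < 1 + `|b| by rewrite ltr_pwDl.
have [l hl] := IHe (eps / 2) ltac:(lra).
have [||x||a ha] := @riesz_approx _ _ _ hip (fun x => ip (K x) b) (M * `|b|)
  (eps / 2 / (1 + `|b|)).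
- by move=> x y; rewrite linearD (ipDl hip).
- by move=> r x; rewrite linearZ /= (ipZl hip).
- by rewrite (le_trans (cauchy_schwarz hip _ _))// mulrAC ler_wpM2r.
- by rewrite divr_gt0//; lra.
exists ((b, a) :: l) => x; rewrite /proj !big_cons -/(proj ip e (K x)) /=.
rewrite opprD addrACA -scalerBl (le_trans (ler_normD _ _))//.
have -> : eps * `|x| = eps / 2 * `|x| + eps / 2 * `|x| by lra.
rewrite lerD// normrZ (le_trans (ler_wpM2r (normr_ge0 b) (ha x)))//.
rewrite mulrAC ler_wpM2r// mulrAC ler_pdivrMr// ler_wpM2l ?lerDr//; lra.
Qed.

Lemma definable_predicate_approx (A : set H) (n m : nat) (P : H -> H -> R) :
  (forall eps, 0 < eps -> exists phi : formula A [:: n; m],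
     forall x y, cball H n x -> cball H m y ->
       `|formula_eval ip phi [:: x; y] - P x y| <= eps) ->
  definable_predicate ip A n m P.
Proof.
move=> hP.
have [phi hphi] :=
  choice (fun k : nat => hP k.+1%:R^-1 ltac:(by rewrite invr_gt0)).
(* From this index on, [k.+1] exceeds the inverse of [eps]. *)
exists phi => eps eps0; exists (Num.truncn eps^-1) => k Nk x y nx my.
rewrite (le_trans (hphi k x y nx my))// -[eps]invrK lef_pV2 ?posrE ?invr_gt0//.
by rewrite (le_trans (ltW (truncnS_gt _)))// ler_nat.
Qed.

Lemma scalar_compact_definable (T : {linear H -> H}) (lambda : R)
    (K : {linear H -> H}) :
  bounded_operator T -> compact_operator K ->
  (forall x, T x = lambda *: x + K x) -> definable ip T.
Proof.
move=> [C hC] cK TE; exists setT; split=> [n n0|n _ m n0 _ _ m0].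
  exists (`|C| * n%:R); split; first exact: num_real.
  move=> M hM _ [x nx <-]; apply: le_trans (ltW hM).
  rewrite (le_trans (hC x))// (le_trans (ler_norm _))//.
  by rewrite normrM normr_id ler_wpM2l.
have bK : bounded_operator K.
  exists (C + `|lambda|) => x.
  have -> : K x = T x - lambda *: x by rewrite TE addrAC subrr add0r.
  by rewrite (le_trans (ler_normB _ _))// normrZ mulrDl lerD.
apply: definable_predicate_approx => eps eps0.
have nR : 0 < n%:R :> R by rewrite ltr0n.
(* Both approximation errors are relative to the norm of [x], at most [n], so each costs
   [eps / 2]. *)
have d0 : 0 < eps / 2 / n%:R by rewrite divr_gt0//; lra.
have [e he] := compact_near_proj cK d0.
have [l hl] := proj_near_finite_rank e bK d0.
have [phi hphi] := formula_fun_finite_rank hip n m lambda l.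
exists phi => x y nx _; rewrite hphi TE.
rewrite (le_trans (ler_dist_dist _ _))// distrC.
have -> : lambda *: x + K x - y - (lambda *: x - y +
    \sum_(p <- l) ip x p.2 *: p.1) = (K x - proj ip e (K x)) +
    (proj ip e (K x) - \sum_(p <- l) ip x p.2 *: p.1).
  rewrite [RHS]addrA subrK [_ + K x - y]addrAC.
  by rewrite [X in _ + X]opprD addrACA subrr add0r.
rewrite (le_trans (ler_normD _ _))// (le_trans (lerD (he x) (hl x)))//.
have h : eps / 2 / n%:R * `|x| <= eps / 2.
  by rewrite mulrAC ler_pdivrMr// ler_wpM2l//; lra.
by lra.
Qed.

End Backward.

Theorem theorem3p1 (R : realType) (H : completeNormedModType R)
    (ip : H -> H -> R) (hip : inner_product ip)
    (hdim : infinite_dimensional H)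
    (T : {linear H -> H}) (hT : bounded_operator T) :
  definable ip T <->
  exists (lambda : R) (K : {linear H -> H}),
    compact_operator K /\ forall x : H, T x = lambda *: x + K x.
Proof.
split; first exact: definable_scalar_compact.
by move=> [lambda [K [cK TE]]]; exact: scalar_compact_definable TE.
Qed.
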